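(* Let $\Omega\subset\mathbb{R}^n$ be measurable with $|\Omega|<\infty$. Let $\theta>0$ and $0<p<\infty$. (i) If $\tau=\infty$, then $$GL_{p,\infty}^\theta(\Omega)=L^{p),\infty,\theta}(\Omega)=L_{p,\infty,\theta}(\Omega).$$ (ii) If $0<\tau<\infty$, then $$L_{p,\tau,\theta}(\Omega)\hookrightarrow GL_{p,\tau}^\theta(\Omega)\hookrightarrow L^{p),\tau,\theta}(\Omega)$$ and $$GL_{p,\tau}^{-\theta}(\Omega)\hookrightarrow L_{p,\tau,-\theta}(\Omega).$$
   Context: $f^*$ denotes the non-increasing rearrangement of a measurable function $f$ on $\Omega$. In all definitions below, when the second index ($q$ or $\tau$) is $\infty$, the expression $(\int_I(\cdot)^q\frac{dt}{t})^{1/q}$ is replaced by $\sup_{t\in I}(\cdot)$. Grand Lorentz space $GL_{p,q}^{\theta}(\Omega)$ ($\theta\in\mathbb{R}$, $0<p<\infty$, $0<q\leqslant\infty$): measurable $f$ with finite $$\|f\|_{GL_{p,q}^\theta(\Omega)}=\begin{cases}\displaystyle\sup_{0<\varepsilon<1}\varepsilon^{\theta}\left(\int_0^1\left(t^{\frac1p+\varepsilon}f^*(t|\Omega|)\right)^q\frac{dt}{t}\right)^{1/q},&\theta\geqslant 0,\\ \displaystyle\inf_{0<\varepsilon<\frac1p}\varepsilon^{\theta}\left(\int_0^1\left(t^{\frac1p-\varepsilon}f^*(t|\Omega|)\right)^q\frac{dt}{t}\right)^{1/q},&\theta<0.\end{cases}$$ Lorentz–Karamata space $L_{p,\tau,\theta}(\Omega)$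 ($\theta\in\mathbb{R}$): measurable $f$ with finite $$\|f\|_{L_{p,\tau,\theta}(\Omega)}=\left(\int_0^1\left(t^{1/p}(1-\ln t)^{-\theta}f^*(t|\Omega|)\right)^\tau\frac{dt}{t}\right)^{1/\tau}.$$ The space $L^{p),\tau,\theta}(\Omega)$ ($\theta>0$): measurable $f$ with finite $$\|f\|_{L^{p),\tau,\theta}(\Omega)}=\sup_{0<s<1}(1-\ln s)^{-\theta}\left(\int_s^1\left(t^{1/p}f^*(t|\Omega|)\right)^\tau\frac{dt}{t}\right)^{1/\tau}.$$ $X\hookrightarrow Y$ means $X\subset Y$ and $\|f\|_Y\leqslant C\|f\|_X$ with $C>0$ independent of $f$; equality of spaces means equality as sets with equivalent quasinorms. *)

(* Defs.v *)
From HB Require Import structures.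
From mathcomp Require Import all_boot all_order all_algebra.
From mathcomp Require Import all_classical all_reals all_analysis.

Set Implicit Arguments.
Unset Strict Implicit.
Unset Printing Implicit Defensive.

Import Order.TTheory GRing.Theory Num.Theory.
Import numFieldNormedType.Exports.

Local Open Scope classical_set_scope.
Local Open Scope ring_scope.

(* Lebesgue measure on R^(n+1), n : nat, is the restriction of the outer
   measure obtained from countable covers by half-open boxes to the sets that
   are measurable in the sense of Caratheodory.  The dimension is written n.+1
   because in dimension 0 no box is empty, so that the cover formula below would
   give the empty set infinite outer measure. *)

Section lebesgue_outer.
Context (R : realType) (n : nat).
Implicit Types (c : 'rV[R]_n.+1 * 'rV[R]_n.+1) (A : set 'rV[R]_n.+1).

Definition box c : set 'rV[R]_n.+1 :=
  [set x | forall i, c.1 ord0 i < x ord0 i <= c.2 ord0 i].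

Definition box_volume c : R :=
  \prod_(i < n.+1) Num.max 0 (c.2 ord0 i - c.1 ord0 i).

Definition box_cover A : set (nat -> 'rV[R]_n.+1 * 'rV[R]_n.+1) :=
  [set c | A `<=` \bigcup_k box (c k)].

Definition lebesgue_outer A : \bar R :=
  ereal_inf [set (\sum_(k <oo) (box_volume (c k))%:E)%E | c in box_cover A].

Local Open Scope ereal_scope.

Lemma box_volume_ge0 c : 0 <= (box_volume c)%:E.
Proof. by rewrite lee_fin prodr_ge0// => i _; rewrite le_max lexx. Qed.

Lemma lebesgue_outer_ge0 A : 0 <= lebesgue_outer A.
Proof.
apply: le_ereal_inf_tmp => _ [c _ <-].
by apply: nneseries_ge0 => k _ _; exact: box_volume_ge0.
Qed.

Lemma lebesgue_outer0 : lebesgue_outer set0 = 0.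
Proof.
apply/eqP; rewrite eq_le lebesgue_outer_ge0 andbT.
apply: ereal_inf_lbound; exists (fun=> (0%R, 0%R)) => //=.
apply: eseries0 => k _ _; rewrite /box_volume /=.
by rewrite big_ord_recl !mxE subrr maxxx mul0r.
Qed.

Lemma le_lebesgue_outer : {homo lebesgue_outer : A B / A `<=` B >-> A <= B}.
Proof.
move=> A B AB; apply: le_ereal_inf_tmp => _ [c Bc <-].
by apply: ereal_inf_lbound; exists c => //; exact: subset_trans Bc.
Qed.

Lemma lebesgue_outer_sigma_subadditive : sigma_subadditive lebesgue_outer.
Proof.
move=> A; have [[i ioo]|] := pselect (exists i, lebesgue_outer (A i) = +oo).
  rewrite (eseries_pinfty _ _ ioo) ?leey// => k _.
  by rewrite -ltNye (lt_le_trans _ (lebesgue_outer_ge0 _)).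
rewrite -forallNE => Aoo.
apply/lee_addgt0Pr => _/posnumP[e].
rewrite (le_trans _ (epsilon_trick _ _ _))//; last first.
  by move=> k; exact: lebesgue_outer_ge0.
pose P k (c : nat -> 'rV[R]_n.+1 * 'rV[R]_n.+1) := box_cover (A k) c /\
  \sum_(j <oo) (box_volume (c j))%:E
    <= lebesgue_outer (A k) + (e%:num / (2 ^ k.+1)%:R)%:E.
have [G PG] : {G & forall k, P k (G k)}.
  apply: (@choice _ _ P) => k; rewrite /P /lebesgue_outer.
  set S := (X in ereal_inf X).
  have Sfin : ereal_inf S \is a fin_num.
    rewrite ge0_fin_numE; last exact: lebesgue_outer_ge0.
    by rewrite ltey; apply/eqP; exact: Aoo.
  have ek : (0 < e%:num / (2 ^ k.+1)%:R)%R by [].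
  have [_ [c Ac <-] /ltW cS] := lb_ereal_inf_adherent ek Sfin.
  by exists c.
pose H := uncurry G.
have H0 x : 0 <= (box_volume (H x))%:E by exact: box_volume_ge0.
apply: (@le_trans _ _ (\esum_(x in [set: nat * nat]) (box_volume (H x))%:E)).
  have /card_esym/ppcard_eqP[f] := card_nat2.
  apply: ereal_inf_lbound; exists (H \o f).
    move=> x [k _ /(PG k).1 [j _ ?]].
    by exists (f^-1%FUN (k, j)) => //=; rewrite invK ?inE.
  rewrite nneseries_esumT//; last by move=> k; exact: box_volume_ge0.
  by rewrite (reindex_esum [set: nat] [set: nat * nat] f).
pose J k : set (nat * nat) := [set (k, j) | j in [set: nat]].
have -> : [set: nat * nat] = \bigcup_k J k.
  by apply/seteqP; split => // -[a b] _; exists a => //; exists b.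
rewrite esum_bigcupT//; last first.
  apply/trivIsetP => i j _ _ ij; apply/seteqP; split => // -[a b] /=.
  by case=> -[? _ [<- _]] [? _ [/esym/eqP]]; rewrite (negbTE ij).
rewrite nneseries_esumT; last first.
  by move=> k; rewrite adde_ge0 ?lebesgue_outer_ge0// lee_fin.
apply: le_esum => k _; apply: le_trans (PG k).2.
rewrite nneseries_esumT//; last by move=> j; exact: box_volume_ge0.
rewrite (reindex_esum [set: nat] (J k) (pair k)) ?lexx//.
split=> [j _|i j _ _ []//|_ [j _ <-]]; by exists j.
Qed.

HB.instance Definition _ := isOuterMeasure.Build R 'rV[R]_n.+1 lebesgue_outer
  lebesgue_outer0 lebesgue_outer_ge0 le_lebesgue_outer
  lebesgue_outer_sigma_subadditive.

End lebesgue_outer.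

(* R^(n+1) with the sigma-algebra of Lebesgue measurable sets. *)
Definition euclidean (R : realType) (n : nat) :=
  caratheodory_type (lebesgue_outer (R := R) (n := n)).

(* The non-increasing rearrangement of f on Omega; it is +oo where no level
   lambda qualifies. *)
Definition rearrangement (R : realType) (n : nat) (Omega : set (euclidean R n))
    (f : euclidean R n -> R) (s : R) : \bar R :=
  ereal_inf [set l%:E | l in
    [set l : R | 0 <= l /\
      (lebesgue_outer (Omega `&` [set x | (l < `|f x|)%R]) <= s%:E)%E]].

(* t |-> f^*(t |Omega|), for Omega of finite measure. *)
Definition scaled_rearrangement (R : realType) (n : nat)
    (Omega : set (euclidean R n)) (f : euclidean R n -> R) (t : R) : \bar R :=
  rearrangement Omega f (t * fine (lebesgue_outer Omega)).

(* (\int_I g^q dt/t)^(1/q), or the (not essential) supremum of g over I when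
   q = +oo; the index -oo is never used. *)
Definition dtt_norm (R : realType) (q : \bar R) (I : set R)
    (g : R -> \bar R) : \bar R :=
  match q with
  | r%:E => ((\int[lebesgue_measure]_(t in I) (g t `^ r * (t^-1)%:E)) `^ r^-1)%E
  | _ => ereal_sup [set g t | t in I]
  end.

(* A space of functions on Omega.  Functions are total on R^(n+1), but only
   their restrictions to Omega are constrained or measured. *)
Record function_space (R : realType) (n : nat) := FunctionSpace {
  space_carrier : set (euclidean R n -> R) ;
  space_norm : (euclidean R n -> R) -> \bar R }.

Definition finite_norm_space (R : realType) (n : nat)
    (Omega : set (euclidean R n)) (N : (euclidean R n -> R) -> \bar R) :=
  FunctionSpace [set f | measurable_fun Omega f /\ (N f < +oo)%E] N.

Definition embeds (R : realType) (n : nat) (X Y : function_space R n) : Prop :=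
  space_carrier X `<=` space_carrier Y /\
  exists2 C : R, 0 < C &
    forall f, space_carrier X f -> (space_norm Y f <= C%:E * space_norm X f)%E.

Definition same_space (R : realType) (n : nat) (X Y : function_space R n)
    : Prop :=
  space_carrier X = space_carrier Y /\
  exists c C : R, [/\ 0 < c, 0 < C & forall f, space_carrier X f ->
    (c%:E * space_norm X f <= space_norm Y f <= C%:E * space_norm X f)%E].

Section spaces.
Context (R : realType) (n : nat).
Implicit Types (theta p : R) (q : \bar R) (Omega : set (euclidean R n)).

Definition grand_lorentz_norm theta p q Omega (f : euclidean R n -> R) :=
  if 0 <= theta then
    ereal_sup [set ((e `^ theta)%:E * dtt_norm q `]0%R, 1%R[ (fun t =>
      (t `^ (p^-1 + e))%:E * scaled_rearrangement Omega f t))%E | e in `]0%R, 1%R[]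
  else
    ereal_inf [set ((e `^ theta)%:E * dtt_norm q `]0%R, 1%R[ (fun t =>
      (t `^ (p^-1 - e))%:E * scaled_rearrangement Omega f t))%E
        | e in `]0, p^-1[].

Definition grand_lorentz theta p q Omega : function_space R n :=
  finite_norm_space Omega (grand_lorentz_norm theta p q Omega).

Definition lorentz_karamata_norm p q theta Omega (f : euclidean R n -> R) :=
  dtt_norm q `]0%R, 1%R[ (fun t =>
    (t `^ p^-1 * (1 - ln t) `^ (- theta))%:E * scaled_rearrangement Omega f t)%E.

Definition lorentz_karamata p q theta Omega : function_space R n :=
  finite_norm_space Omega (lorentz_karamata_norm p q theta Omega).

(* The space L^{p),q,theta}. *)
Definition truncated_lorentz_norm p q theta Omega (f : euclidean R n -> R) :=
  ereal_sup [set (((1 - ln s) `^ (- theta))%:E * dtt_norm q `]s, 1%R[ (fun t =>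
    (t `^ p^-1)%:E * scaled_rearrangement Omega f t))%E | s in `]0%R, 1%R[].

Definition truncated_lorentz p q theta Omega : function_space R n :=
  finite_norm_space Omega (truncated_lorentz_norm p q theta Omega).

End spaces.

(* Main.v *)
Require Import Defs.
From mathcomp Require Import all_boot all_order all_algebra.
From mathcomp Require Import all_classical all_reals all_analysis.
From mathcomp Require Import measurable_realfun.

Set Implicit Arguments.
Unset Strict Implicit.
Unset Printing Implicit Defensive.

Import Order.TTheory GRing.Theory Num.Theory.
Import numFieldNormedType.Exports.

Local Open Scope classical_set_scope.
Local Open Scope ring_scope.

(** All the norms compared here apply one and the same weighted norm, an L^q
    norm for dt/t or a supremum, to a single non-increasing function
    g(t) = f^*(t |Omega|); only the weight in front of g and the interval
    differ.  Such norms are monotone and homogeneous in the weight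
    ([dtt_norm_weight_le]), uniformly in 0 < q <= +oo, so every comparison of
    spaces reduces to a pointwise inequality between weights.

    Put L = 1 - ln t >= 1.  Since t^e = exp(e) exp(- e L), the factor
    e^theta t^e equals L^(-theta) times exp(e) x^theta exp(-x) at x = e L.  The
    function x^theta exp(-x) is bounded on the half-line, whence
    e^theta t^e <= C L^(-theta) with C locally uniform in e
    ([grand_weight_le]).  For e < 1 this bounds the grand norm by the
    Lorentz-Karamata norm; for e < 1/p, after moving both factors to the other
    side, it bounds the Lorentz-Karamata norm of index -theta by every member
    of the infimum that defines the grand norm of index -theta.

    The bound is attained up to a constant when e L = 1: with
    e = 1 / (1 - ln s), the factor t^e stays above exp(-1) for all t >= s
    ([matched_power_ge]), so that each truncated norm is dominated by one
    member of the supremum that defines the grand norm.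

    For q = +oo the chain truncated <= grand <= Karamata closes up, because a
    supremum sees a single point t: the truncation at s = t^2 retains t, and
    replacing t by t^2 at most doubles 1 - ln t ([logweight_sqr_le]). *)

(** * Weight inequalities *)

Section weights.
Context {R : realType}.
Implicit Types theta e s t : R.

(** The inequality y <= exp y at y = x / theta, raised to the power theta. *)
Lemma powR_le_expR theta x : 0 < theta -> 0 <= x ->
  x `^ theta <= theta `^ theta * expR x.
Proof.
move=> th0 x0.
have -> : expR x = (expR (x / theta)) `^ theta :> R.
  by rewrite -expRM divfK// gt_eqF.
rewrite -powRM ?expR_ge0 ?(ltW th0)//.
apply: ge0_ler_powR; rewrite ?nnegrE ?mulr_ge0 ?expR_ge0 ?(ltW th0)//.
rewrite -ler_pdivrMl// mulrC (le_trans _ (expR_ge1Dx _))//.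
by rewrite lerDr.
Qed.

Lemma logweight_ge1 t : t <= 1 -> 1 <= 1 - ln t.
Proof. by move=> t1; rewrite lerBrDr gerDl ln_le0. Qed.

(** With x = e (1 - ln t) one has t^e = exp e exp(-x), and [powR_le_expR] bounds
    x^theta exp(-x). *)
Lemma grand_weight_le theta e t : 0 < theta -> 0 < e -> 0 < t <= 1 ->
  e `^ theta * t `^ e
    <= theta `^ theta * expR e * (1 - ln t) `^ (- theta).
Proof.
move=> th0 e0 /andP[t0 t1].
have L1 := logweight_ge1 t1; have L0 := lt_le_trans ltr01 L1.
rewrite powRN ler_pdivlMr ?powR_gt0//.
rewrite mulrAC -powRM ?(ltW e0) ?(ltW L0)//.
have -> : t `^ e = expR e * expR (- (e * (1 - ln t))).
  by rewrite /powR gt_eqF// -expRD mulrBr mulr1 opprB addrCA subrr addr0.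
rewrite mulrA mulrAC ler_wpM2r ?expR_ge0// expRN ler_pdivrMr ?expR_gt0//.
by apply: powR_le_expR; rewrite // mulr_ge0 ?(ltW e0) ?(ltW L0).
Qed.

(** Already t^e >= s^e = exp(ln s / (1 - ln s)) for e = 1 / (1 - ln s), and the
    exponent ln s / (1 - ln s) stays above -1. *)
Lemma matched_power_ge s t : 0 < s -> s <= t <= 1 ->
  expR (- 1) <= t `^ (1 - ln s)^-1.
Proof.
move=> s0 /andP[st t1]; have t0 := lt_le_trans s0 st.
have L1 := logweight_ge1 (le_trans st t1); have L0 := lt_le_trans ltr01 L1.
rewrite /powR gt_eqF// ler_expR mulrC ler_pdivlMr// mulN1r opprB lerBlDr.
by rewrite (le_trans (_ : ln s <= ln t))// ?ler_ln// lerDl.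
Qed.

(** Squaring t at most doubles 1 - ln t, while t^2 < t leaves room for a
    truncation strictly below t. *)
Lemma logweight_sqr_le theta t : 0 < theta -> 0 < t <= 1 ->
  (1 - ln t) `^ (- theta) <= 2 `^ theta * (1 - ln (t ^+ 2)) `^ (- theta).
Proof.
move=> th0 /andP[t0 t1].
have L1 := logweight_ge1 t1; have L0 := lt_le_trans ltr01 L1.
have M1 := @logweight_ge1 (t ^+ 2) (exprn_ile1 _ (ltW t0) t1).
have M0 := lt_le_trans ltr01 M1.
rewrite !powRN ler_pdivlMr ?powR_gt0// mulrC ler_pdivrMr ?powR_gt0//.
rewrite -powRM ?(ltW L0)//.
apply: ge0_ler_powR; rewrite ?nnegrE ?mulr_ge0 ?(ltW th0) ?(ltW L0) ?(ltW M0)//.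
by rewrite lnXn// mulrBr mulr1 mulr_natl lerD2r ler1n.
Qed.

Lemma measurable_powR_logweight (a b : R) :
  measurable_fun setT (fun t : R => t `^ a * (1 - ln t) `^ b).
Proof.
apply: measurable_funM; first exact: measurable_powR.
apply: (measurableT_comp (measurable_powR b)).
by apply: measurable_funB => //; exact: measurable_ln.
Qed.

End weights.

(** * Comparison of weighted norms *)

Section dtt_norms.
Context {R : realType}.
Implicit Types (I J : set R) (g h k : R -> \bar R) (v w : R -> R) (q : \bar R).

(** The superlevel sets of g are intervals. *)
Lemma nonincreasing_measurable_ereal (D : set R) g : measurable D ->
  {homo g : s t / s <= t >-> (t <= s)%E} -> measurable_fun D g.
Proof.
move=> mD g_ni.
apply: (measurability _ (ErealGenCInfty.measurableE R)) => // _ [_ [x ->] <-].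
apply: measurableI => //; apply: is_interval_measurable => s t /=.
rewrite !in_itv/= !andbT => _ xt u /andP[_ ut].
by rewrite in_itv/= andbT (le_trans xt)// g_ni.
Qed.

Lemma measurable_dtt_integrand I (r : R) h :
    measurable I -> I `<=` `]0, +oo[ -> measurable_fun setT h ->
  measurable_fun I (fun t => h t `^ r * (t^-1)%:E)%E.
Proof.
move=> mI I0 mh; apply: emeasurable_funM.
  apply: measurable_funTS; exact: (measurableT_comp (measurable_poweR r) mh).
(* The inverse agrees with the power -1 on the positive half-line but not on
   the whole line, hence the restriction to I. *)
apply: (eq_measurable_fun (fun t : R => (t `^ (-1))%:E)).
  move=> t; rewrite inE => /I0; rewrite /= in_itv/= andbT => t0.
  by rewrite powR_inv1// ltW.
by apply: measurable_funTS; apply/measurable_EFinP; exact: measurable_powR.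
Qed.

Lemma dtt_integrand_ge0 I (r : R) h t : I `<=` `]0, +oo[ -> I t ->
  (0 <= h t `^ r * (t^-1)%:E)%E.
Proof.
move=> I0 /I0; rewrite /= in_itv/= andbT => t0.
by rewrite mule_ge0 ?poweR_ge0// lee_fin invr_ge0 ltW.
Qed.

Lemma le_dtt_norm q I J h k : (0 < q)%E -> measurable I -> measurable J ->
    I `<=` J -> J `<=` `]0, +oo[ ->
    measurable_fun setT h -> measurable_fun setT k ->
    (forall t, 0 <= h t)%E -> (forall t, I t -> h t <= k t)%E ->
  (dtt_norm q I h <= dtt_norm q J k)%E.
Proof.
move=> q0 mI mJ IJ J0 mh mk h0 hk.
have I0 := subset_trans IJ J0.
case: q q0 => [r|_|//]; last first.
  apply: ge_ereal_sup => _ [t It <-]; apply: (le_trans (hk t It)).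
  by apply: ereal_sup_ubound; exists t => //; exact: IJ.
rewrite lte_fin => r0 /=.
have int_ge0 I' h' : I' `<=` `]0, +oo[ ->
    (0 <= \int[lebesgue_measure]_(t in I') (h' t `^ r * (t^-1)%:E))%E.
  by move=> I'0; apply: integral_ge0 => t; exact: dtt_integrand_ge0.
apply: gt0_ler_poweR;
  rewrite ?invr_ge0 ?(ltW r0) ?in_itv/= ?leey ?int_ge0//.
apply: (@le_trans _ _
    (\int[lebesgue_measure]_(t in I) (k t `^ r * (t^-1)%:E))%E); last first.
  apply: ge0_subset_integral => //; first exact: measurable_dtt_integrand.
  by move=> t; exact: dtt_integrand_ge0.
apply: ge0_le_integral => //; try exact: measurable_dtt_integrand.
  by move=> t; exact: dtt_integrand_ge0.
move=> t It; have := I0 _ It; rewrite /= in_itv/= andbT => t0.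
rewrite lee_wpmul2r ?lee_fin ?invr_ge0 ?(ltW t0)//.
apply: gt0_ler_poweR; rewrite ?(ltW r0) ?in_itv/= ?leey ?andbT ?h0 ?hk//.
exact: le_trans (hk _ It).
Qed.

Lemma dtt_normZ q I h (c : R) : (0 < q)%E -> measurable I -> I `<=` `]0, +oo[ ->
    measurable_fun setT h -> (forall t, 0 <= h t)%E -> 0 < c ->
  dtt_norm q I (fun t => c%:E * h t)%E = (c%:E * dtt_norm q I h)%E.
Proof.
move=> q0 mI I0 mh h0 c0; case: q q0 => [r|_|//]; last first.
  by rewrite /= -ereal_sup_pZl// image_comp.
rewrite lte_fin => r0 /=.
under eq_integral.
  move=> t _; rewrite poweRM ?lee_fin ?(ltW c0)// poweR_EFin -muleA; over.
rewrite ge0_integralZl_EFin ?powR_ge0//; last first.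
- exact: measurable_dtt_integrand.
- by move=> t; exact: dtt_integrand_ge0.
rewrite poweRM ?lee_fin ?powR_ge0//; last first.
  by apply: integral_ge0 => t; exact: dtt_integrand_ge0.
by rewrite poweR_EFin -powRrM divff ?gt_eqF// powRr1 ?(ltW c0).
Qed.

(** Homogeneity moves the constants into the weights, and monotonicity does the
    rest.  The conclusion has a constant on both sides because the norms to be
    compared are suprema and infima of norms scaled by e^theta or by
    (1 - ln s)^(-theta). *)
Lemma dtt_norm_weight_le q I J g v w (a b : R) :
    (0 < q)%E -> measurable I -> measurable J -> I `<=` J -> J `<=` `]0, +oo[ ->
    measurable_fun setT g -> measurable_fun setT v -> measurable_fun setT w ->
    (forall t, 0 <= g t)%E -> (forall t, 0 <= v t) -> (forall t, 0 <= w t) ->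
    0 < a -> 0 < b -> (forall t, I t -> a * v t <= b * w t) ->
  (a%:E * dtt_norm q I (fun t => (v t)%:E * g t)
    <= b%:E * dtt_norm q J (fun t => (w t)%:E * g t))%E.
Proof.
move=> q0 mI mJ IJ J0 mg mv mw g0 v0 w0 a0 b0 vw.
have m (u : R -> R) :
    measurable_fun setT u -> measurable_fun setT (fun t => (u t)%:E * g t)%E.
  by move=> mu; apply: emeasurable_funM => //; exact/measurable_EFinP.
have ge0 (u : R -> R) :
    (forall t, 0 <= u t) -> (forall t, 0 <= (u t)%:E * g t)%E.
  by move=> u0 t; rewrite mule_ge0 ?lee_fin.
have I0 := subset_trans IJ J0.
rewrite -(dtt_normZ q0 mI I0 (m v mv) (ge0 v v0) a0).
rewrite -(dtt_normZ q0 mJ J0 (m w mw) (ge0 w w0) b0).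
apply: le_dtt_norm => //; try by apply: measurable_funeM; exact: m.
  by move=> t; rewrite mule_ge0 ?ge0// lee_fin ltW.
by move=> t It; rewrite !muleA -!EFinM lee_wpmul2r// lee_fin vw.
Qed.

End dtt_norms.

(** * Rearrangements *)

Section scaled_rearrangements.
Context {R : realType} {n : nat}.
Context (Omega : set (euclidean R n)) (f : euclidean R n -> R).

Lemma scaled_rearrangement_ge0 t : (0 <= scaled_rearrangement Omega f t)%E.
Proof. by apply: le_ereal_inf_tmp => _ [l [l0 _] <-]; rewrite lee_fin. Qed.

Lemma scaled_rearrangement_nonincreasing :
  {homo scaled_rearrangement Omega f : s t / s <= t >-> (t <= s)%E}.
Proof.
move=> s t st; apply: ereal_inf_le_tmp => _ [l [l0 ls] <-]; exists l => //.
split=> //; apply: (le_trans ls).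
by rewrite lee_fin ler_wpM2r// fine_ge0// lebesgue_outer_ge0.
Qed.

Lemma measurable_scaled_rearrangement :
  measurable_fun setT (scaled_rearrangement Omega f).
Proof.
apply: nonincreasing_measurable_ereal => //.
exact: scaled_rearrangement_nonincreasing.
Qed.

End scaled_rearrangements.

(** * Comparison of the three scales of spaces *)

Section comparison.
Context {R : realType} {n : nat}.
Context (Omega : set (euclidean R n)) (theta p : R) (q : \bar R).
Context (theta0 : 0 < theta) (q0 : (0 < q)%E).
Implicit Types f : euclidean R n -> R.

Let sub01 (s : R) : 0 <= s -> `]s, 1[ `<=` `]0, 1[.
Proof.
by move=> s0 t /=; rewrite !in_itv/= => /andP[st ->]; rewrite (le_lt_trans s0).
Qed.

Let sub0y : `]0%R : R, 1[ `<=` `]0, +oo[.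
Proof. by move=> t /=; rewrite !in_itv/= andbT => /andP[]. Qed.

Lemma le_scaled_dtt_norm (I J : set R) f (v w : R -> R) (a b : R) :
    measurable I -> measurable J -> I `<=` J -> J `<=` `]0, 1[ ->
    measurable_fun setT v -> measurable_fun setT w ->
    (forall t, 0 <= v t) -> (forall t, 0 <= w t) -> 0 < a -> 0 < b ->
    (forall t, 0 < t < 1 -> I t -> a * v t <= b * w t) ->
  (a%:E * dtt_norm q I (fun t => (v t)%:E * scaled_rearrangement Omega f t)
    <= b%:E * dtt_norm q J
         (fun t => (w t)%:E * scaled_rearrangement Omega f t))%E.
Proof.
move=> mI mJ IJ J01 mv mw v0 w0 a0 b0 vw.
apply: dtt_norm_weight_le => //.
- exact: subset_trans sub0y.
- exact: measurable_scaled_rearrangement.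
- exact: scaled_rearrangement_ge0.
by move=> t It; apply: vw => //; have /J01 := IJ _ It; rewrite /= in_itv.
Qed.

(** The parameter e stays below 1, so the factor exp e of [grand_weight_le] is
    at most exp 1. *)
Lemma grand_le_karamata : exists2 C : R, 0 < C & forall f,
  (grand_lorentz_norm theta p q Omega f
    <= C%:E * lorentz_karamata_norm p q theta Omega f)%E.
Proof.
have C0 : 0 < theta `^ theta * expR 1 by rewrite mulr_gt0 ?powR_gt0 ?expR_gt0.
exists (theta `^ theta * expR 1) => // f.
rewrite /grand_lorentz_norm (ltW theta0).
apply: ge_ereal_sup => _ [e /=+ <-]; rewrite in_itv/= => /andP[e0 e1].
apply: le_scaled_dtt_norm => //.
- exact: measurable_powR_logweight.
- by move=> t; rewrite powR_ge0.
- by move=> t; rewrite mulr_ge0 ?powR_ge0.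
- exact: powR_gt0.
move=> t /andP[t0 t1] _.
rewrite powRD ?(gt_eqF t0) ?implybT//.
rewrite mulrCA [leRHS]mulrCA ler_wpM2l ?powR_ge0//.
apply: le_trans (grand_weight_le theta0 e0 _) _; first by rewrite t0 ltW.
by rewrite ler_wpM2r ?powR_ge0// ler_wpM2l ?powR_ge0// ler_expR ltW.
Qed.

(** The truncation at s is controlled by the single parameter
    e = 1 / (1 - ln s), for which e^theta is exactly the weight
    (1 - ln s)^(-theta). *)
Lemma truncated_le_grand : exists2 C : R, 0 < C & forall f,
  (truncated_lorentz_norm p q theta Omega f
    <= C%:E * grand_lorentz_norm theta p q Omega f)%E.
Proof.
exists (expR 1) => [|f]; first exact: expR_gt0.
rewrite /grand_lorentz_norm (ltW theta0).
apply: ge_ereal_sup => _ [s /=+ <-]; rewrite in_itv/= => /andP[s0 s1].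
have L1 : 1 < 1 - ln s by rewrite ltrBrDr gtrDl ln_lt0 ?s0.
have L0 := lt_trans ltr01 L1.
set e := (1 - ln s)^-1.
have e0 : 0 < e by rewrite invr_gt0.
apply: (@le_trans _ _ ((expR 1 * e `^ theta)%:E *
    dtt_norm q `]0%R, 1%R[ (fun t =>
      (t `^ (p^-1 + e))%:E * scaled_rearrangement Omega f t))%E); last first.
  rewrite EFinM -muleA lee_wpmul2l ?lee_fin ?expR_ge0//.
  apply: ereal_sup_ubound; exists e => //=.
  by rewrite in_itv/= e0 invf_lt1.
apply: le_scaled_dtt_norm => //.
- by apply: sub01; exact: ltW.
- by move=> t; rewrite powR_ge0.
- by move=> t; rewrite powR_ge0.
- exact: powR_gt0.
- by rewrite mulr_gt0 ?powR_gt0 ?expR_gt0.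
move=> t /andP[t0 t1] /=; rewrite in_itv/= => /andP[st _].
rewrite powRD ?(gt_eqF t0) ?implybT//.
have -> : e `^ theta = (1 - ln s) `^ (- theta).
  by rewrite /e -powR_inv1 ?(ltW L0)// -powRrM mulN1r.
rewrite (mulrC (expR 1)) mulrACA ler_peMr ?mulr_ge0 ?powR_ge0//.
rewrite -ler_pdivrMl ?expR_gt0// mulr1 -expRN.
by rewrite matched_power_ge// (ltW st) ltW.
Qed.

(** Reading [grand_weight_le] as (1 - ln t)^theta <= C e^(-theta) t^(-e) bounds
    the norm by each member of the infimum; the range e < 1/p keeps exp e
    bounded. *)
Lemma karamata_le_dual_grand : exists2 C : R, 0 < C & forall f,
  (lorentz_karamata_norm p q (- theta) Omega f
    <= C%:E * grand_lorentz_norm (- theta) p q Omega f)%E.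
Proof.
have C0 : 0 < theta `^ theta * expR p^-1.
  by rewrite mulr_gt0 ?powR_gt0 ?expR_gt0.
exists (theta `^ theta * expR p^-1) => // f.
rewrite /grand_lorentz_norm oppr_ge0 (lt_geF theta0) -ereal_inf_pZl//.
apply: le_ereal_inf_tmp => _ [_ [e /=+ <-] <-].
rewrite in_itv/= => /andP[e0 ep].
rewrite muleA -EFinM -[leLHS]mul1e.
apply: le_scaled_dtt_norm => //.
- exact: measurable_powR_logweight.
- by move=> t; rewrite mulr_ge0 ?powR_ge0.
- by move=> t; rewrite powR_ge0.
- by rewrite mulr_gt0 ?powR_gt0.
move=> t /andP[t0 t1] _; rewrite mul1r opprK.
rewrite powRD ?(gt_eqF t0) ?implybT// [leRHS]mulrCA ler_wpM2l ?powR_ge0//.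
rewrite !powRN.
have L1 := logweight_ge1 (ltW t1); have L0 := lt_le_trans ltr01 L1.
rewrite ler_pdivlMr ?powR_gt0// ler_pdivlMr ?powR_gt0//.
rewrite mulrC mulrCA mulrC -ler_pdivlMr ?powR_gt0//.
have t01 : 0 < t <= 1 by rewrite t0 ltW.
rewrite mulrC -powRN mulrC; apply: le_trans (grand_weight_le theta0 e0 t01) _.
by rewrite ler_wpM2r ?powR_ge0// ler_wpM2l ?powR_ge0// ler_expR ltW.
Qed.

End comparison.

(** Specific to suprema: the value at one point t is already seen by the
    truncation at t^2. *)
Lemma karamata_le_truncated_oo (R : realType) (n : nat)
    (Omega : set (euclidean R n)) (theta p : R) : 0 < theta ->
  exists2 C : R, 0 < C & forall f,
    (lorentz_karamata_norm p +oo theta Omega f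
      <= C%:E * truncated_lorentz_norm p +oo theta Omega f)%E.
Proof.
move=> theta0; exists (2 `^ theta) => [|f]; first exact: powR_gt0.
apply: ge_ereal_sup => _ [t /=+ <-]; rewrite in_itv/= => /andP[t0 t1].
have tt : t ^+ 2 < t by rewrite expr2 gtr_pMr.
apply: (@le_trans _ _ ((2 `^ theta * (1 - ln (t ^+ 2)) `^ (- theta))%:E *
    ((t `^ p^-1)%:E * scaled_rearrangement Omega f t))%E).
  rewrite muleA -EFinM lee_wpmul2r ?scaled_rearrangement_ge0// lee_fin.
  by rewrite mulrC ler_wpM2r ?powR_ge0// logweight_sqr_le// t0 ltW.
rewrite EFinM -muleA lee_wpmul2l ?lee_fin ?powR_ge0//.
apply: (@le_trans _ _ (((1 - ln (t ^+ 2)) `^ (- theta))%:E *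
    dtt_norm +oo `](t ^+ 2)%R, 1%R[ (fun t =>
      (t `^ p^-1)%:E * scaled_rearrangement Omega f t))%E).
  rewrite lee_wpmul2l ?lee_fin ?powR_ge0//; apply: ereal_sup_ubound.
  by exists t => //=; rewrite in_itv/= tt.
apply: ereal_sup_ubound; exists (t ^+ 2) => //=.
by rewrite in_itv/= exprn_gt0// (lt_trans tt).
Qed.

(** * Inclusions of spaces *)

(** Inclusion of carriers comes for free, as the bound is assumed for all f and
    transports finiteness. *)
Lemma embeds_of_le (R : realType) (n : nat) (Omega : set (euclidean R n))
    (M N : (euclidean R n -> R) -> \bar R) :
  (exists2 C : R, 0 < C & forall f, (N f <= C%:E * M f)%E) ->
  embeds (finite_norm_space Omega M) (finite_norm_space Omega N).
Proof.
move=> [C C0 NM]; split; last by exists C.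
move=> f [mf Mf]; split=> //; apply: le_lt_trans (NM f) _.
case: (M f) Mf => [r _|//|_]; rewrite -?EFinM ?ltry//.
by rewrite gt0_muleNy ?lte_fin// ltNyr.
Qed.

Lemma same_space_of_le (R : realType) (n : nat) (Omega : set (euclidean R n))
    (M N : (euclidean R n -> R) -> \bar R) :
  (exists2 C : R, 0 < C & forall f, (N f <= C%:E * M f)%E) ->
  (exists2 C : R, 0 < C & forall f, (M f <= C%:E * N f)%E) ->
  same_space (finite_norm_space Omega M) (finite_norm_space Omega N).
Proof.
move=> NM MN; split.
  by apply/seteqP; split; [case: (embeds_of_le Omega NM)
                          |case: (embeds_of_le Omega MN)].
case: NM MN => [C C0 NM] [D D0 MN]; exists D^-1, C; split; rewrite ?invr_gt0//.
move=> f _; rewrite NM andbT.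
by rewrite lee_pdivrMl.
Qed.

Lemma dominates_trans (R : realType) (T : Type) (K M N : T -> \bar R) :
  (exists2 C : R, 0 < C & forall f, (K f <= C%:E * M f)%E) ->
  (exists2 C : R, 0 < C & forall f, (M f <= C%:E * N f)%E) ->
  (exists2 C : R, 0 < C & forall f, (K f <= C%:E * N f)%E).
Proof.
move=> [C C0 KM] [D D0 MN]; exists (C * D) => [|f]; first exact: mulr_gt0.
by rewrite (le_trans (KM f))// EFinM -muleA lee_wpmul2l// lee_fin ltW.
Qed.

Theorem lemma2p5 (R : realType) (n : nat) (Omega : set (euclidean R n))
    (theta p : R) :
  measurable Omega -> (lebesgue_outer Omega < +oo)%E ->
  0 < theta -> 0 < p ->
  (same_space (grand_lorentz theta p +oo%E Omega)
              (truncated_lorentz p +oo%E theta Omega) /\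
   same_space (truncated_lorentz p +oo%E theta Omega)
              (lorentz_karamata p +oo%E theta Omega)) /\
  (forall tau : R, 0 < tau ->
   [/\ embeds (lorentz_karamata p tau%:E theta Omega)
              (grand_lorentz theta p tau%:E Omega),
       embeds (grand_lorentz theta p tau%:E Omega)
              (truncated_lorentz p tau%:E theta Omega) &
       embeds (grand_lorentz (- theta) p tau%:E Omega)
              (lorentz_karamata p tau%:E (- theta) Omega)]).
Proof.
move=> _ _ theta0 p0; split; last first.
  move=> tau tau0; split; apply: embeds_of_le.
  - exact: grand_le_karamata.
  - exact: truncated_le_grand.
  - exact: karamata_le_dual_grand.
have GK := @grand_le_karamata R n Omega theta p +oo%E theta0 (ltry 0).
have TG := @truncated_le_grand R n Omega theta p +oo%E theta0 (ltry 0).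
have KT := @karamata_le_truncated_oo R n Omega theta p theta0.
split; apply: same_space_of_le => //.
- exact: dominates_trans GK KT.
- exact: dominates_trans TG GK.
Qed.
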